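(* Let $d\in\mathbb{N}$, $d\ge1$. For any nonnegative nonzero function $u\in L^1(\mathbb{R}^d)\cap L^\infty(\mathbb{R}^d)$ and for all real $0\le m\le d$, there holds $$\int_{\mathbb{R}^d}|x|^m\,(u(x)-u^*(x))\,dx\ \ge\ \frac{m}{4d}\,K_d^{-m/d}\,\|u\|_{L^1}^{-1+m/d}\,\|u\|_{L^\infty}^{-m/d}\,\|u-u^*\|_{L^1}^2 .$$
   Context: $K_d$ is the volume of the unit ball of $\mathbb{R}^d$, and $u^*$ is the Schwarz (symmetric decreasing) rearrangement of $u$ on $\mathbb{R}^d$: $u^*(x)=u^\sharp(K_d|x|^d)$, where $u^\sharp(s)=\inf\{t\ge0:\ \mathrm{meas}\{u>t\}\le s\}$. The integral on the left is understood in $[-\infty,+\infty]$, whenever it is well defined. *)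

(* Defs.v *)
From HB Require Import structures.
From mathcomp Require Import all_boot all_order all_algebra.
From mathcomp Require Import all_classical all_reals all_analysis.

Set Implicit Arguments.
Unset Strict Implicit.
Unset Printing Implicit Defensive.

Import Order.TTheory GRing.Theory Num.Theory.
Import numFieldNormedType.Exports.

Local Open Scope classical_set_scope.
Local Open Scope ring_scope.

(* R^d, with the product (= Borel) sigma-algebra that the library puts on
   tuples. *)
Notation Rn R d := (d.-tuple (measurableTypeR R)).

Section cons_measure.
Local Open Scope ereal_scope.
Context (disp : measure_display) (T : measurableType disp) (R : realType).
Variables (n : nat) (nu : {sigma_finite_measure set T -> \bar R}).
Variable mu : {sigma_finite_measure set (n.-tuple T) -> \bar R}.

Definition tuple_of_pair (p : T * n.-tuple T) : n.+1.-tuple T :=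
  [tuple of p.1 :: p.2].

Definition pair_of_tuple (t : n.+1.-tuple T) : T * n.-tuple T :=
  (thead t, [tuple of behead t]).

Lemma tuple_of_pairK : cancel tuple_of_pair pair_of_tuple.
Proof.
move=> [a t]; rewrite /pair_of_tuple /tuple_of_pair theadE; congr pair.
exact/val_inj.
Qed.

Lemma measurable_tuple_of_pair : measurable_fun setT tuple_of_pair.
Proof. exact: measurable_cons. Qed.

Lemma measurable_pair_of_tuple : measurable_fun setT pair_of_tuple.
Proof.
apply: measurable_fun_pair; last exact: measurable_behead.
exact: measurable_tnth.
Qed.

Definition cons_measure : set (n.+1.-tuple T) -> \bar R :=
  pushforward (nu \x mu) tuple_of_pair.

Let pushforward_cons : {measure set (n.+1.-tuple T) -> \bar R} :=
  measure_function_pushforward__canonical__measure_function_Measure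
    (nu \x mu)%E measurable_tuple_of_pair.

Let cons_measure0 : cons_measure set0 = 0.
Proof. exact: (measure0 pushforward_cons). Qed.

Let cons_measure_ge0 A : 0 <= cons_measure A.
Proof. exact: (measure_ge0 pushforward_cons). Qed.

Let cons_measure_semi_sigma_additive : semi_sigma_additive cons_measure.
Proof. exact: (@measure_semi_sigma_additive _ _ _ pushforward_cons). Qed.

HB.instance Definition _ := isMeasure.Build _ _ _ cons_measure
  cons_measure0 cons_measure_ge0 cons_measure_semi_sigma_additive.

Let cons_measure_sigma_finite : sigma_finite setT cons_measure.
Proof.
have /sigma_finiteP[F [TF ndF Foo]] := sigma_finiteT nu.
have /sigma_finiteP[G [TG ndG Goo]] := sigma_finiteT mu.
exists (fun k => pair_of_tuple @^-1` (F k `*` G k)).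
  rewrite -preimage_bigcup (_ : \bigcup_k _ = setT) ?preimage_setT//.
  apply/seteqP; split=> // -[x y] _.
  have [k _ Fkx] : (\bigcup_k F k) x by rewrite -TF.
  have [l _ Gly] : (\bigcup_k G k) y by rewrite -TG.
  exists (maxn k l) => //; split.
    by move: x Fkx; exact/subsetPset/ndF/leq_maxl.
  by move: y Gly; exact/subsetPset/ndG/leq_maxr.
move=> k; have [mF Fk] := Foo k; have [mG Gk] := Goo k; split.
  rewrite -[X in measurable X]setTI; apply: measurable_pair_of_tuple => //.
  exact: measurableX.
rewrite /cons_measure /pushforward -comp_preimage.
rewrite (_ : _ \o _ = id) ?preimage_id; last exact/funext/tuple_of_pairK.
by rewrite product_measure1E// lte_mul_pinfty// ge0_fin_numE.
Qed.

HB.instance Definition _ := Measure_isSigmaFinite.Build _ _ _ cons_measure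
  cons_measure_sigma_finite.

End cons_measure.

(* Lebesgue measure on R^d, as the d-fold product of the Lebesgue measure on R:
   lambda_0 is the unit mass at the empty tuple, and lambda_(d+1) is
   lambda_1 \x lambda_d carried to tuples by (a, t) |-> a :: t. *)
Fixpoint lebesgue_Rn (R : realType) (d : nat) :
    {sigma_finite_measure set (Rn R d) -> \bar R} :=
  match d with
  | 0 => @dirac _ (Rn R 0) [tuple] R
  | d'.+1 => cons_measure (@lebesgue_measure R) (lebesgue_Rn R d')
  end.

Lemma lebesgue_Rn_box (R : realType) (d : nat)
    (A : 'I_d -> set (measurableTypeR R)) : (forall i, measurable (A i)) ->
  (lebesgue_Rn R d [set x | forall i, A i (tnth x i)]
   = \big[mule/1]_(i < d) lebesgue_measure (A i))%E.
Proof.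
elim: d A => [|d ih] A mA.
  rewrite big_ord0 /= diracE mem_set//=; by case.
rewrite big_ord_recl -ih//=.
rewrite /cons_measure /pushforward.
pose B := [set x : Rn R d | forall i, A (lift ord0 i) (tnth x i)].
have mB : measurable B.
  have -> : B = \bigcap_(i in [set: 'I_d])
      ((fun x : Rn R d => tnth x i) @^-1` A (lift ord0 i)).
    by apply/seteqP; split=> [x Bx i _|x Bx i]; [exact: Bx|exact: (Bx i)].
  apply: fin_bigcap_measurable => // i _.
  rewrite -[X in measurable X]setTI.
  exact: measurable_tnth.
rewrite -(product_measure1E _ _ (mA ord0) mB); congr (_ _).
apply/seteqP; split=> [[a t] /= H|[a t] [/= Aa Bt] i].
  split; first exact: (H ord0).
  by move=> i /=; have := H (lift ord0 i); rewrite tnthS.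
have [j ->|->] := unliftP ord0 i; last exact: Aa.
by rewrite tnthS; exact: Bt.
Qed.

Section rearrangement.
Context (R : realType) (d : nat).
Implicit Types (x : Rn R d) (u : Rn R d -> R).

Definition enorm x : R := Num.sqrt (\sum_(i < d) (tnth x i : R) ^+ 2).

Definition unit_ball_volume : R :=
  fine (lebesgue_Rn R d [set x | enorm x <= 1]).

(* For s >= 0 and u essentially bounded, the set below is nonempty and bounded
   from below, so that the real-valued inf is the genuine infimum. *)
Definition decr_rearr u (s : R) : R :=
  inf [set t | 0 <= t /\ (lebesgue_Rn R d [set x | (t < u x)%R] <= s%:E)%E].

Definition schwarz_rearr u x : R :=
  decr_rearr u (unit_ball_volume * enorm x ^+ d).

End rearrangement.
Arguments unit_ball_volume : clear implicits.

(* The library's integral is \int f^+ - \int f^-, with the convention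
   +oo - oo = -oo; it is meaningful exactly under the condition below. *)
Definition integral_well_defined (disp : measure_display)
    (T : measurableType disp) (R : realType) (mu : {measure set T -> \bar R})
    (f : T -> \bar R) : Prop :=
  (\int[mu]_x f^\+ x < +oo)%E \/ (\int[mu]_x f^\- x < +oo)%E.

(* Main.v *)
(** Write [p = m / d], [K = unit_ball_volume R d] and [s x = K |x|^d], so that
    [|x|^m = K^(-p) (s x)^p] and the set [s <= r] has measure [r].  For [t > 0]
    let [E = {u > t}], [a = meas E] and [B = {v > t} = {s < a}], where
    [v = schwarz_rearr u]; then [E \ B] and [B \ E] have the same measure [b].
    Since the distribution function of [s] on [E \ B] dominates that of
    [y |-> a + y] on [0, b], and the one on [B \ E] is dominated by that of
    [y |-> a - y],
      int_(E \ B) s^p - int_(B \ E) s^p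
        >= int_0^b ((a + y)^p - (a - y)^p) dy >= p a^(p-1) b^2.
    Instead of Cauchy-Schwarz and Hoelder in [t], the last term is linearised:
    for [c >= 0] and [l > 0],
      a^(p-1) b^2 >= 2 c b - c^2 ((1 - p) l^(-p) a + p l^(1-p)).
    This is linear in [(a, b)], so it can be integrated over
    [0 < t < ||u||_oo] with all terms put on the side where they are
    nonnegative.  The claim is the case [l = ||u||_1 / ||u||_oo] and
    [c = ||u - v||_1 / (2 ||u||_1^(1-p) ||u||_oo^p)].  As the positive and
    negative parts of [|x|^m (u - v)] are kept apart, the negative part turns
    out to be integrable as soon as the positive part is. *)
Require Import Defs.
From mathcomp Require Import all_boot all_order all_algebra.
From mathcomp Require Import all_classical all_reals all_analysis.
From mathcomp Require Import measurable_realfun ess_sup_inf.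
From mathcomp Require Import ring lra.

Set Implicit Arguments.
Unset Strict Implicit.
Unset Printing Implicit Defensive.

Import Order.TTheory GRing.Theory Num.Theory.
Import numFieldNormedType.Exports.
Local Open Scope classical_set_scope.
Local Open Scope ring_scope.

(** * Inequalities for real powers *)

Section real_powers.
Context {R : realType}.
Implicit Types a x y p q : R.

(** Convexity of [expR]: its tangent at [q * ln x], evaluated at [ln x] and at [0] with weights [q]
    and [1 - q], loses its slope term. *)
Lemma powR_le_tangent1 x q : 0 < x -> 0 <= q <= 1 -> x `^ q <= 1 + q * (x - 1).
Proof.
move=> x0 /andP[q0 q1].
have tangent w : x `^ q * (1 + (w - q * ln x)) <= expR w.
  have -> : expR w = x `^ q * expR (w - q * ln x).
    by rewrite /powR gt_eqF// -expRD addrC subrK.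
  by rewrite ler_wpM2l ?powR_ge0// expR_ge1Dx.
have h1 := tangent (ln x); have h0 := tangent 0.
rewrite lnK ?posrE// in h1; rewrite expR0 in h0.
have {h1}h1 := ler_wpM2l q0 h1.
have q1' : 0 <= 1 - q by rewrite subr_ge0.
have {h0}h0 := ler_wpM2l q1' h0.
by move: h0 h1; set P := x `^ q; set l := ln x; nra.
Qed.

(** The tangent at [l] of the concave map [z |-> z ^ (1 - p)], obtained from the tangent at [1] by
    homogeneity. *)
Lemma powR_le_tangent a l p : 0 < a -> 0 < l -> 0 <= p <= 1 ->
  a `^ (1 - p) <= (1 - p) * l `^ (- p) * a + p * l `^ (1 - p).
Proof.
move=> a0 l0 p01; have al0 : 0 < a / l by rewrite divr_gt0.
have q01 : 0 <= 1 - p <= 1 by lra.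
have := powR_le_tangent1 al0 q01.
move=> /(ler_wpM2l (powR_ge0 l (1 - p))).
rewrite -powRM ?(ltW l0) ?(ltW al0)// (mulrC l) mulfVK ?gt_eqF//.
move=> /le_trans; apply; rewrite le_eqVlt; apply/orP; left; apply/eqP.
have -> : l `^ (1 - p) = l * l `^ (- p).
  rewrite powRD; first by rewrite powRr1 ?ltW.
  by rewrite (gt_eqF l0) implybT.
by field; exact: lt0r_neq0.
Qed.

Lemma powR_ge_tangent1 x q : 0 < x -> q <= 0 -> 1 + q * (x - 1) <= x `^ q.
Proof.
move=> x0 q0; rewrite /powR gt_eqF//.
apply: le_trans (expR_ge1Dx _); rewrite lerD2l ler_wnM2l//.
by have := le_ln1Dx (x := x - 1); rewrite (addrC 1) subrK; apply; lra.
Qed.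

(** The right side minus the left, [f], vanishes at [0]. Its derivative [df] is nonnegative because
    [z |-> z ^ (p - 1)] is convex: its values at [a + x] and [a - x] average to at least its value
    at [a]. *)
Lemma powR_sub_ge a y p : 0 <= p <= 1 -> 0 <= y < a ->
  2 * p * a `^ (p - 1) * y <= (a + y) `^ p - (a - y) `^ p.
Proof.
move=> /andP[p0 p1] /andP[y0 ya].
have a0 : 0 < a by exact: le_lt_trans ya.
pose df x := p * (a + x) `^ (p - 1) + p * (a - x) `^ (p - 1)
  - 2 * p * a `^ (p - 1).
pose f x := (a + x) `^ p - (a - x) `^ p - (2 * p * a `^ (p - 1)) * x.
have isd x : x \in `](- a), a[ -> is_derive x 1 f (df x).
  rewrite in_itv/= => /andP[ax xa].
  have ax0 : 0 < a + x by lra.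
  have xa0 : 0 < a - x by lra.
  have d1 : is_derive x 1 (fun x : R => (a + x) `^ p) (p * (a + x) `^ (p - 1)).
    have := is_derive1_comp (is_derive1_powR p ax0)
      (is_deriveD (is_derive_cst a x 1) (is_derive_id x 1)).
    by rewrite add0r mulr1.
  have d2 : is_derive x 1 (fun x : R => (a - x) `^ p)
      (- (p * (a - x) `^ (p - 1))).
    have := @is_derive1_comp _ (fun z : R => z `^ p) (fun z : R => a - z) x _ _
      (is_derive1_powR p xa0)
      (is_deriveB (is_derive_cst a x 1) (is_derive_id x 1)).
    by rewrite sub0r mulrN1.
  have d3 := is_deriveZ (2 * p * a `^ (p - 1)) (is_derive_id x 1).
  have := is_deriveB (is_deriveB d1 d2) d3.
  rewrite opprK.
  suff -> : (2 * p * a `^ (p - 1)) *: (1 : R) = 2 * p * a `^ (p - 1) by [].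
  exact: mulr1.
have dfge x : x \in `]0, y[ -> 0 <= df x.
  rewrite in_itv/= => /andP[x0 xy].
  (* Tangent at [a] of this convex power; for [z = x] and [z = - x] the linear terms cancel in the
     sum. *)
  have tangent z : 0 < a + z ->
      a `^ (p - 1) * (1 + (p - 1) * (z / a)) <= (a + z) `^ (p - 1).
    move=> az0; have aza : 0 < (a + z) / a by rewrite divr_gt0.
    have -> : a + z = a * ((a + z) / a) by rewrite mulrC divfK ?gt_eqF.
    rewrite powRM ?(ltW a0) ?(ltW aza)//.
    apply: ler_wpM2l; first exact: powR_ge0.
    have -> : z / a = (a + z) / a - 1.
      by rewrite mulrDl divff ?gt_eqF// addrAC subrr add0r.
    by apply: powR_ge_tangent1 => //; lra.
  have tD : a `^ (p - 1) * (1 + (p - 1) * (x / a)) <= (a + x) `^ (p - 1).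
    by apply: tangent; lra.
  have tB : a `^ (p - 1) * (1 + (p - 1) * (- x / a)) <= (a - x) `^ (p - 1).
    by apply: tangent; lra.
  have -> : df x =
      p * ((a + x) `^ (p - 1) + (a - x) `^ (p - 1) - 2 * a `^ (p - 1)).
    by rewrite /df; ring.
  rewrite mulr_ge0//; move: tD tB; rewrite mulNr.
  by set z := x / a; lra.
have sub x : x \in `[0, y] -> x \in `](- a), a[.
  by rewrite !in_itv/=; move=> /andP[]; lra.
suff : f 0 <= f y by rewrite /f addr0 subr0 mulr0 subrr; lra.
apply: (@ger0_derive1_le_cc _ f 0 y); rewrite ?in_itv/= ?lexx ?y0//.
- move=> x xy; have [] := isd x => //; apply: sub.
  exact: subset_itv_oo_cc xy.
- move=> x xy; rewrite derive1E.
  have [_ ->] := isd x (sub _ (subset_itv_oo_cc xy)).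
  exact: dfge.
apply: derivable_within_continuous => x xy.
by have [] := isd x (sub _ xy).
Qed.
(** Serves to turn a superlevel set of [s ^ p] into one of [s]. *)
Lemma lt_powR_root p v z : 0 < p -> 0 <= v -> 0 <= z ->
  (v < z `^ p) = (v `^ p^-1 < z).
Proof.
move=> p0 v0 z0; have vE : v = (v `^ p^-1) `^ p.
  by rewrite -powRrM mulVf ?gt_eqF// powRr1.
have r0 : v `^ p^-1 \in Num.nneg by rewrite nnegrE powR_ge0.
apply/idP/idP => [|rz]; last first.
  by rewrite vE; apply: gt0_ltr_powR.
apply: contraLR; rewrite -!leNgt => zr.
by rewrite vE; apply: ge0_ler_powR => //; exact: ltW.
Qed.

End real_powers.

(** * Layer cake formulas *)

Section measurable_levels.
Context d (T : measurableType d) (R : realType).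
Implicit Types f g : T -> R.

Lemma measurable_set_lt f g :
  measurable_fun setT f -> measurable_fun setT g ->
  measurable [set x | f x < g x].
Proof.
move=> mf mg.
have /(_ measurableT [set true]) := measurable_fun_ltr mf mg.
by rewrite setTI; exact.
Qed.

Lemma measurable_set_le f g :
  measurable_fun setT f -> measurable_fun setT g ->
  measurable [set x | f x <= g x].
Proof.
move=> mf mg.
have /(_ measurableT [set true]) := measurable_fun_ler mf mg.
by rewrite setTI; exact.
Qed.

Lemma measurable_level_band f g t :
  measurable_fun setT f -> measurable_fun setT g ->
  measurable [set x | f x <= t < g x].
Proof.
move=> mf mg.
have -> : [set x | f x <= t < g x] = [set x | f x <= t] `&` [set x | t < g x].
  by apply/seteqP; split=> x /= => [/andP[]|[-> ->]].
by apply: measurableI; [exact: measurable_set_le|exact: measurable_set_lt].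
Qed.

End measurable_levels.

Section layer_cake.
Local Open Scope ereal_scope.
Context d (T : measurableType d) (R : realType).
Variable mu : {sigma_finite_measure set T -> \bar R}.
Local Notation lambda := (@lebesgue_measure R).
Variables (w f g : T -> R).
Hypotheses (mw : measurable_fun setT w) (mf : measurable_fun setT f).
Hypotheses (mg : measurable_fun setT g) (w0 : forall x, (0 <= w x)%R).

(** The weight [w] spread over the region between the graphs of [f] and [g]. With the half-open
    condition, the band at height [t] is exactly [{g > t} \ {f > t}]. *)
Let h (p : T * measurableTypeR R) :=
  (w p.1 * \1_[set p : T * measurableTypeR R | (f p.1 <= p.2 < g p.1)%R] p)%:E.

Let h_ge0 p : 0 <= h p.
Proof. by rewrite lee_fin mulr_ge0. Qed.

Let mh : measurable_fun setT h.
Proof.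
apply/measurable_EFinP; apply: measurable_funM; first exact: measurableT_comp.
apply: measurable_indic.
rewrite (_ : [set _ | _] =
    [set p : T * measurableTypeR R | (f p.1 <= p.2)%R] `&`
    [set p : T * measurableTypeR R | (p.2 < g p.1)%R]).
  apply: measurableI.
    by apply: measurable_set_le => //; exact: measurableT_comp.
  by apply: measurable_set_lt => //; exact: measurableT_comp.
by apply/seteqP; split=> x /= => [/andP[]|[-> ->]].
Qed.

Let band t : \int[mu]_x h (x, t) =
  \int[mu]_(x in [set x | (f x <= t < g x)%R]) (w x)%:E.
Proof.
rewrite [RHS]integral_mkcond; apply: eq_integral => x _.
rewrite patchE /h /= indicE.
have -> :
    ((x, t) \in [set p : T * measurableTypeR R | (f p.1 <= p.2 < g p.1)%R])
    = (x \in [set x | (f x <= t < g x)%R]).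
  by apply/idP/idP; rewrite !inE.
by case: ifPn; rewrite (mulr1, mulr0).
Qed.

Lemma measurable_band_integral D : measurable D -> measurable_fun D
  (fun t : measurableTypeR R =>
    \int[mu]_(x in [set x | (f x <= t < g x)%R]) (w x)%:E).
Proof.
move=> mD; apply: measurable_funTS.
rewrite (_ : (fun _ => _) = fubini_G mu h); last first.
  by apply/funext => t; rewrite /fubini_G -band.
exact: measurable_fun_fubini_tonelli_G.
Qed.

(** Tonelli for [h]: at fixed [x] the inner integral is [w x] times the length of [[f x, g x[],
    which is [0] when [g x <= f x]. Outside [D] all bands are empty. *)
Lemma layer_cake (D : set (measurableTypeR R)) : measurable D ->
  (forall x t, (f x <= t < g x)%R -> D t) ->
  \int[mu]_x (w x * Num.max (g x - f x) 0)%:E =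
  \int[lambda]_(t in D) \int[mu]_(x in [set x | (f x <= t < g x)%R]) (w x)%:E.
Proof.
move=> mD fgD.
transitivity (\int[mu]_x \int[lambda]_t h (x, t)).
  apply: eq_integral => x _.
  transitivity (\int[lambda]_t ((w x)%:E *
      (\1_(`[f x, g x[%classic : set (measurableTypeR R)) t)%:E)); last first.
    by apply: eq_integral => t _; rewrite /h /= EFinM; congr (_ * _).
  rewrite ge0_integralZl//; last first.
  - by rewrite lee_fin.
  - by apply/measurable_EFinP; exact: measurable_indic.
  rewrite integral_indic// setIT EFinM; congr (_ * _).
  rewrite /= lebesgue_measure_itv/= lte_fin.
  case: ifPn => [fg|]; first by rewrite -EFinB max_l// subr_ge0 ltW.
  by rewrite -leNgt => gf; rewrite max_r// subr_le0.
rewrite fubini_tonelli// [RHS]integral_mkcond.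
apply: eq_integral => t _; rewrite patchE band; case: ifPn => // /negP tD.
rewrite (_ : [set _ | _] = set0) ?integral_set0//.
by apply/seteqP; split=> x //= /fgD Dt; apply: tD; rewrite inE.
Qed.

End layer_cake.

Section integral_distribution.
Local Open Scope ereal_scope.
Context d (T : measurableType d) (R : realType).
Variable mu : {sigma_finite_measure set T -> \bar R}.
Variables (A : set T) (f : T -> R).
Hypotheses (mA : measurable A) (mf : measurable_fun setT f).
Hypothesis f0 : forall x, A x -> (0 <= f x)%R.

Let indic_cst0 (v : R) : (0 <= v)%R ->
  \int[mu]_(x in [set x | (cst 0 x <= v < f x)%R]) (\1_A x)%:E =
  mu (A `&` [set x | v < f x]%R).
Proof.
move=> v0; rewrite integral_indic//=; last first.
  by apply: measurable_level_band => //; exact: measurable_cst.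
by congr (mu (_ `&` _)); apply/seteqP; split=> x /=; rewrite v0.
Qed.

Lemma measurable_distribution :
  measurable_fun (`[0%R, +oo[%classic : set (measurableTypeR R))
    (fun v => mu (A `&` [set x | v < f x]%R)).
Proof.
apply: (eq_measurable_fun (fun v : R =>
  \int[mu]_(x in [set x | (cst 0 x <= v < f x)%R]) (\1_A x)%:E)).
  by move=> v; rewrite inE/= in_itv/= andbT => v0; exact: indic_cst0.
exact: (@measurable_band_integral _ _ _ mu \1_A).
Qed.

Lemma integral_distribution :
  \int[mu]_(x in A) (f x)%:E =
  \int[@lebesgue_measure R]_(v in `[0%R, +oo[) mu (A `&` [set x | v < f x]%R).
Proof.
have mA1 : measurable_fun setT (\1_A : T -> R) by exact: measurable_indic.
transitivity (\int[mu]_x (\1_A x * Num.max (f x - cst 0%R x) 0)%:E).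
  rewrite [LHS]integral_mkcond; apply: eq_integral => x _.
  rewrite patchE indicE.
  case: ifPn => [xA|_]; last by rewrite mul0r.
  by rewrite subr0 mul1r max_l// f0//; rewrite inE in xA.
rewrite (@layer_cake _ _ _ mu \1_A (cst 0%R) f _ _ _ _ `[0%R, +oo[%classic)//.
- apply: eq_integral => v; rewrite inE/= in_itv/= andbT => v0.
  exact: indic_cst0.
- by move=> x t /=; rewrite in_itv/= andbT => /andP[].
Qed.

End integral_distribution.

(** The two functions may live on different spaces: this compares [s ^ p] on a subset of [T] with an
    explicit power on an interval of the line. *)
Lemma le_integral_distribution d1 d2 (T1 : measurableType d1)
    (T2 : measurableType d2) (R : realType)
    (mu1 : {sigma_finite_measure set T1 -> \bar R})
    (mu2 : {sigma_finite_measure set T2 -> \bar R})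
    (A1 : set T1) (A2 : set T2) (f1 : T1 -> R) (f2 : T2 -> R) :
  measurable A1 -> measurable A2 ->
  measurable_fun setT f1 -> measurable_fun setT f2 ->
  (forall x, A1 x -> 0 <= f1 x) -> (forall x, A2 x -> 0 <= f2 x) ->
  (forall v, 0 <= v -> (mu1 (A1 `&` [set x | (v < f1 x)%R])
     <= mu2 (A2 `&` [set x | (v < f2 x)%R]))%E) ->
  (\int[mu1]_(x in A1) (f1 x)%:E <= \int[mu2]_(x in A2) (f2 x)%:E)%E.
Proof.
move=> mA1 mA2 mf1 mf2 f10 f20 le12; rewrite !integral_distribution//.
apply: ge0_le_integral => //; [exact: measurable_distribution..|].
by move=> v /=; rewrite in_itv/= andbT; exact: le12.
Qed.

(** * The inequality on one level *)

Section bathtub.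
Local Open Scope ereal_scope.
Context d (T : measurableType d) (R : realType).
Variable mu : {sigma_finite_measure set T -> \bar R}.
Variable s : T -> R.
Hypotheses (ms : measurable_fun setT s) (s0 : forall x, (0 <= s x)%R).
Hypothesis mu_le : forall r : R, (0 <= r)%R -> mu [set x | (s x <= r)%R] = r%:E.
Local Notation lambda := (@lebesgue_measure R).

Let measurable_le r : measurable [set x | (s x <= r)%R].
Proof. by apply: measurable_set_le => //; exact: measurable_cst. Qed.

Let measurable_lt r : measurable [set x | (s x < r)%R].
Proof. by apply: measurable_set_lt => //; exact: measurable_cst. Qed.

(** If the mass [m] of [{s < r}] were below [r], the set [{s <= (m + r) / 2}] would lie inside it
    and yet have the larger mass [(m + r) / 2]. *)
Lemma mu_lt (r : R) : (0 <= r)%R -> mu [set x | (s x < r)%R] = r%:E.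
Proof.
move=> r0; have le_r : mu [set x | (s x < r)%R] <= r%:E.
  by rewrite -mu_le//; apply: le_measure; rewrite ?inE//= => x /=; exact: ltW.
have fin : mu [set x | (s x < r)%R] \is a fin_num.
  by rewrite ge0_fin_numE// (le_lt_trans le_r)// ltry.
apply/eqP; rewrite eq_le le_r/= -(fineK fin) lee_fin leNgt; apply/negP.
set m := fine _ => mr.
have m0 : (0 <= m)%R by rewrite fine_ge0.
have : ((m + r) / 2)%:E <= mu [set x | (s x < r)%R].
  rewrite -mu_le; last by lra.
  by apply: le_measure; rewrite ?inE//= => x /=; lra.
by rewrite -(fineK fin) lee_fin -/m; lra.
Qed.

Variables (a : R) (E : set T).
Hypotheses (a0 : (0 < a)%R) (mE : measurable E) (muE : mu E = a%:E).
Let B := [set x | (s x < a)%R].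
Let b := fine (mu (E `\` B)).

Let mB : measurable B. Proof. exact: measurable_lt. Qed.
Let muB : mu B = a%:E. Proof. exact: mu_lt (ltW a0). Qed.
Let mEB : measurable (E `\` B). Proof. exact: measurableD. Qed.
Let mBE : measurable (B `\` E). Proof. exact: measurableD. Qed.

Let muEB : mu (E `\` B) = b%:E.
Proof.
rewrite fineK// ge0_fin_numE// (@le_lt_trans _ _ (mu E))//.
  by apply: le_measure; rewrite ?inE.
by rewrite muE ltry.
Qed.

(** [E] and [B] have the same finite measure; removing their intersection leaves equal masses. *)
Lemma muBE : mu (B `\` E) = b%:E.
Proof.
have hB : a%:E = mu (B `\` E) + mu (B `&` E).
  by rewrite -measureDI.
have hE : a%:E = b%:E + mu (B `&` E).
  by rewrite -muE -muEB (setIC B E) -measureDI.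
have fin : mu (B `&` E) \is a fin_num.
  rewrite ge0_fin_numE// (@le_lt_trans _ _ (mu E))//; last by rewrite muE ltry.
  by apply: le_measure; rewrite ?inE//; exact: measurableI.
have : mu (B `\` E) + mu (B `&` E) = b%:E + mu (B `&` E) by rewrite -hB.
by move=> /(congr1 (fun z => z - mu (B `&` E))); rewrite !addeK.
Qed.

Let b0 : (0 <= b)%R. Proof. exact: fine_ge0. Qed.
Let ba : (b <= a)%R.
Proof. by rewrite -lee_fin -muEB -muE le_measure ?inE. Qed.

(** Points of [E \ B] with [s x <= tau] lie in the shell [a <= s x <= tau], of mass [tau - a]; the
    others carry the rest of [b]. *)
Let far_mass (tau : R) : (a <= tau)%R ->
  (b - (tau - a))%:E <= mu ((E `\` B) `&` [set x | (tau < s x)%R]).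
Proof.
move=> at_; have t0 : (0 <= tau)%R := le_trans (ltW a0) at_.
have band : mu ([set x | (s x <= tau)%R] `\` B) = (tau - a)%:E.
  transitivity (mu [set x | (s x <= tau)%R] - mu B); last by rewrite muB mu_le.
  have le_lty : mu [set x | (s x <= tau)%R] < +oo by rewrite mu_le// ltry.
  rewrite measureD//; congr (_ - mu _).
  apply/seteqP; split=> x /= => [[]//|]; rewrite /B/= => xa; split=> //=.
  exact: le_trans (ltW xa) _.
rewrite EFinB leeBlDr// -band -muEB.
have mfar : measurable ((E `\` B) `&` [set x | (tau < s x)%R]).
  by apply: measurableI => //; apply: measurable_set_lt => //;
    exact: measurable_cst.
have mband : measurable ([set x | (s x <= tau)%R] `\` B) by exact: measurableD.
apply: (le_trans _ (measureU2 _ mfar mband)).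
rewrite le_measure ?inE//; first exact: measurableU.
move=> x [Ex Bx]; have [sx|sx] := leP (s x) tau; first by right.
by left.
Qed.

(** These points lie in the shell [tau < s x < a], of mass [a - tau], and [B \ E] has mass [b] in
    all. *)
Let near_mass (tau : R) : (0 <= tau < a)%R ->
  mu ((B `\` E) `&` [set x | (tau < s x)%R]) <= (Num.min b (a - tau))%:E.
Proof.
move=> /andP[t0 ta].
have mnear : measurable ((B `\` E) `&` [set x | (tau < s x)%R]).
  by apply: measurableI => //; apply: measurable_set_lt => //;
    exact: measurable_cst.
have ring_mass : mu (B `\` [set x | (s x <= tau)%R]) = (a - tau)%:E.
  transitivity (mu B - mu [set x | (s x <= tau)%R]); last by rewrite muB mu_le.
  have B_lty : mu B < +oo by rewrite muB ltry.
  rewrite measureD//; congr (_ - mu _).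
  apply/seteqP; split=> x /= => [[]//|sx]; split=> //.
  by rewrite /B/= (le_lt_trans sx).
rewrite EFin_min le_min -muBE -ring_mass; apply/andP; split.
  by rewrite le_measure ?inE.
rewrite le_measure ?inE//; first exact: measurableD.
by move=> x [[Bx _] /= tx]; split=> //=; apply/negP; rewrite -ltNge.
Qed.

Variable p : R.
Hypothesis p01 : (0 <= p <= 1)%R.

Let ms_powR : measurable_fun setT (fun x => (s x `^ p)%R).
Proof. exact: measurableT_comp (measurable_powR p) ms. Qed.

(** The extremal case is [E \ B] filling the shell just outside [B], where [s] is distributed like
    [a + y] for [0 < y < b]. *)
Let integral_far : (0 < p)%R ->
  \int[lambda]_(y in `]0%R, b[) ((a + y) `^ p)%:E
  <= \int[mu]_(x in E `\` B) (s x `^ p)%:E.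
Proof.
move=> p0; apply: le_integral_distribution => //.
- by apply: (measurableT_comp (measurable_powR p)); exact: measurable_funD.
- by move=> x _; exact: powR_ge0.
- by move=> x _; exact: powR_ge0.
move=> v v0.
pose tau := (v `^ p^-1)%R.
have tau0 : (0 <= tau)%R by exact: powR_ge0.
have gt_tau (z : R) : (0 <= z)%R -> (v < z `^ p)%R = (tau < z)%R.
  exact: lt_powR_root.
have -> : [set x | v < s x `^ p]%R = [set x | (tau < s x)%R].
  by apply/funext => x /=; rewrite gt_tau.
(* On []0, b[], [tau < a + y] means [lo < y]; the maximum with [0] covers [tau < a], where all of
   [E \ B] lies above the level. *)
pose lo := Num.max 0%R (tau - a)%R.
have -> : (`]0%R, b[%classic `&` [set x | (v < (a + x) `^ p)%R]) =
    `]lo, b[%classic :> set (measurableTypeR R).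
  apply/seteqP; split=> x /=; rewrite !in_itv/= gt_max ltrBlDl.
    move=> [/andP[x0 xb]]; rewrite gt_tau ?addr_ge0 ?(ltW a0) ?(ltW x0)// => ->.
    by rewrite x0 xb.
  move=> /andP[/andP[x0 tx] xb]; split; first by rewrite x0.
  by rewrite gt_tau ?addr_ge0 ?(ltW a0) ?(ltW x0).
rewrite /= lebesgue_measure_itv/= lte_fin; case: ifPn => // lob.
have [at_|ta] := leP a tau.
  apply: le_trans (far_mass at_); rewrite lee_fin.
  by rewrite /lo max_r ?subr_ge0//; lra.
rewrite /lo max_l ?subr_le0 ?(ltW ta)// oppr0 adde0 -muEB.
rewrite (_ : _ `&` _ = E `\` B)//.
apply/seteqP; split=> x /= => [[]//|[Ex Bx]]; split=> //.
by apply: (lt_le_trans ta); rewrite leNgt; apply/negP.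
Qed.

(** Here the extremal case is [B \ E] filling the shell just inside the boundary of [B], where [s]
    is distributed like [a - y]. *)
Let integral_near : (0 < p)%R ->
  \int[mu]_(x in B `\` E) (s x `^ p)%:E
  <= \int[lambda]_(y in `]0%R, b[) ((a - y) `^ p)%:E.
Proof.
move=> p0; apply: le_integral_distribution => //.
- by apply: (measurableT_comp (measurable_powR p)); exact: measurable_funB.
- by move=> x _; exact: powR_ge0.
- by move=> x _; exact: powR_ge0.
move=> v v0.
pose tau := (v `^ p^-1)%R.
have tau0 : (0 <= tau)%R by exact: powR_ge0.
have gt_tau (z : R) : (0 <= z)%R -> (v < z `^ p)%R = (tau < z)%R.
  exact: lt_powR_root.
have -> : [set x | v < s x `^ p]%R = [set x | (tau < s x)%R].
  by apply/funext => x /=; rewrite gt_tau.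
have [at_|ta] := leP a tau.
  rewrite (_ : _ `&` _ = set0) ?measure0//.
  by apply/seteqP; split=> x //= [[]]; rewrite /B/=; lra.
apply: (le_trans (near_mass _)); first by rewrite tau0.
have -> : (`]0%R, b[%classic `&` [set x | (v < (a - x) `^ p)%R]) =
    `]0%R, Num.min b (a - tau)%R[%classic :> set (measurableTypeR R).
  apply/seteqP; split=> x /=; rewrite !in_itv/= lt_min.
    move=> [/andP[x0 xb]]; rewrite gt_tau ?subr_ge0 ?(le_trans (ltW xb))//.
    by rewrite x0 xb ltrBrDl -ltrBrDr.
  move=> /andP[x0 /andP[xb tx]]; split; first by rewrite x0.
  by rewrite gt_tau ?subr_ge0 ?(le_trans (ltW xb))// ltrBrDl -ltrBrDr.
rewrite /= lebesgue_measure_itv/= lte_fin; case: ifPn => [_|].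
  by rewrite oppr0 adde0.
by rewrite -leNgt => ?; rewrite lee_fin.
Qed.

Let integral_linear (k : R) : (0 <= k)%R ->
  \int[lambda]_(y in `]0%R, b[) (2 * k * y)%:E = (k * b ^+ 2)%:E.
Proof.
move=> k0; move: b0; rewrite le_eqVlt => /predU1P[<-|b_gt0].
  by rewrite set_itvoo0 integral_set0 expr0n mulr0.
pose F (y : R) := (k * (y * y))%R.
have dF (y : R) : is_derive y 1%R F (2 * k * y)%R.
  have := is_deriveZ k (is_deriveM (is_derive_id y 1%R) (is_derive_id y 1%R)).
  have -> : (k *: ((y : R) *: (1 : R) + (y : R) *: (1 : R)) = 2 * k * y)%R.
    by rewrite /GRing.scale/=; ring.
  exact.
have cF : continuous F.
  move=> y; apply/differentiable_continuous/derivable1_diffP.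
  by have [] := dF y.
rewrite -(@integral_itv_bndoo _ _ _ _ true false).
  rewrite (@continuous_FTC2 _ _ F)//.
  - by rewrite /F !mulr0 sube0 expr2.
  - apply: continuous_subspaceT => y.
    by apply: cvgM; [exact: cvg_cst|exact: cvg_id].
  - split=> [y _||]; first by have [] := dF y.
    + by apply: cvg_at_right_filter; exact: cF.
    + by apply: cvg_at_left_filter; exact: cF.
  - by move=> y _; rewrite derive1E; have [_ ->] := dF y.
apply/measurable_EFinP; exact: measurable_funM.
Qed.

Lemma bathtub :
  \int[mu]_(x in B `\` E) (s x `^ p)%:E + (p * a `^ (p - 1) * b ^+ 2)%:E
  <= \int[mu]_(x in E `\` B) (s x `^ p)%:E.
Proof.
(* The comparison of distributions takes a [p]-th root and requires [0 < p]. For [p = 0] the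
   integrands are constantly [1] and both integrals equal [b]. *)
have /andP[p0 p1] := p01; move: p0; rewrite le_eqVlt => /predU1P[p0|p0].
  rewrite -p0 !mul0r adde0.
  under eq_integral do rewrite powRr0.
  under [leRHS]eq_integral do rewrite powRr0.
  rewrite !integral_cst// !mul1e le_eqVlt; apply/orP; left; apply/eqP.
  exact: etrans muBE (esym muEB).
apply: (le_trans _ (integral_far p0)).
apply: (le_trans (leeD2r _ (integral_near p0))).
have c0 : (0 <= p * a `^ (p - 1))%R by rewrite mulr_ge0 ?powR_ge0// ltW.
have mlin : measurable_fun (`]0%R, b[ : set (measurableTypeR R))
    (fun y => (2 * (p * a `^ (p - 1)) * y)%:E).
  by apply/measurable_EFinP; exact: measurable_funM.
have mpow (g : R -> R) : measurable_fun setT g ->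
    measurable_fun (`]0%R, b[ : set (measurableTypeR R))
      (fun y => (g y `^ p)%:E).
  move=> mg; apply/measurable_EFinP/measurable_funTS.
  exact: measurableT_comp (measurable_powR p) mg.
have mid := @measurable_id _ (measurableTypeR R) setT.
have mpowB := mpow _ (measurable_funB (measurable_cst a) mid).
have mpowD := mpow _ (measurable_funD (measurable_cst a) mid).
have lin0 (y : R) : y \in `]0%R, b[ -> 0 <= (2 * (p * a `^ (p - 1)) * y)%:E.
  rewrite in_itv/= => /andP[y0 _]; rewrite lee_fin.
  by apply: mulr_ge0; [exact: mulr_ge0|exact: ltW].
(* The term quadratic in [b] becomes the integral of [2 * p * a ^ (p - 1) * y], so that
   [powR_sub_ge] applies under the integral; [y < b <= a] supplies its hypothesis. *)
rewrite -integral_linear// -ge0_integralD//; last 1 first.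
- by move=> y _; rewrite lee_fin powR_ge0.
apply: ge0_le_integral => //.
- by move=> y yb; rewrite adde_ge0 ?lin0// lee_fin powR_ge0.
- exact: emeasurable_funD.
move=> y /=; rewrite in_itv/= => /andP[y0 yb].
rewrite -EFinD lee_fin -lerBrDl.
have := @powR_sub_ge _ a y p p01; rewrite mulrA; apply.
by rewrite (ltW y0) (lt_le_trans yb).
Qed.

End bathtub.

(** * Integration over the levels *)

Section stability.
Local Open Scope ereal_scope.
Context d (T : measurableType d) (R : realType).
Variable mu : {sigma_finite_measure set T -> \bar R}.
Variable s : T -> R.
Hypotheses (ms : measurable_fun setT s) (s0 : forall x, (0 <= s x)%R).
Hypothesis mu_le : forall r : R, (0 <= r)%R -> mu [set x | (s x <= r)%R] = r%:E.
Variable p : R.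
Hypothesis p01 : (0 <= p <= 1)%R.

(** The two masses on the left both equal [b], but are kept as a sum because that sum integrates
    over the levels to the [L^1] distance of [u] and [v]. *)
Lemma bathtub_linearized (a c l : R) (E : set T) :
  measurable E -> mu E = a%:E -> (0 <= c)%R -> (0 < l)%R ->
  \int[mu]_(x in [set x | (s x < a)%R] `\` E) (s x `^ p)%:E
    + (p * c)%:E * (mu (E `\` [set x | (s x < a)%R])
                    + mu ([set x | (s x < a)%R] `\` E))
  <= \int[mu]_(x in E `\` [set x | (s x < a)%R]) (s x `^ p)%:E
    + (p * c ^+ 2 * ((1 - p) * l `^ (- p) * a + p * l `^ (1 - p)))%:E.
Proof.
move=> mE muE c0 l0; set B := [set x | _]; have /andP[p0 p1] := p01.
have p'0 : (0 <= 1 - p)%R by rewrite subr_ge0.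
have a_ge0 : (0 <= a)%R by rewrite -lee_fin -muE.
have mB : measurable B by apply: measurable_set_lt => //; exact: measurable_cst.
have tail_ge0 : (0 <=
    p * c ^+ 2 * ((1 - p) * l `^ (- p) * a + p * l `^ (1 - p)))%R.
  by rewrite mulr_ge0 ?addr_ge0 ?mulr_ge0 ?powR_ge0 ?exprn_ge0.
(* [bathtub] requires [0 < a]. For [a = 0] the set [B] is empty and [E] is null, so the left side is
   [0]. *)
move: a_ge0; rewrite le_eqVlt => /predU1P[a0|a0].
  have B0 : B = set0.
    by apply/seteqP; split=> x //; rewrite /B/= -a0 ltNge s0.
  rewrite B0 set0D setD0 integral_set0 measure0 muE.
  have -> : (p * c)%:E * (a%:E + 0) = 0 by rewrite -a0 adde0 mule0.
  rewrite adde0 adde_ge0 ?lee_fin//.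
  by apply: integral_ge0 => x _; rewrite lee_fin powR_ge0.
have main := bathtub ms s0 mu_le a0 mE muE p01; rewrite -/B in main.
have muBEb := muBE ms mu_le a0 mE muE; rewrite -/B in muBEb main.
have mEB : measurable (E `\` B) by exact: measurableD.
have muEBb : mu (E `\` B) = (fine (mu (E `\` B)))%:E.
  rewrite fineK// ge0_fin_numE// (@le_lt_trans _ _ (mu E))//.
    by apply: le_measure; rewrite ?inE.
  by rewrite muE ltry.
rewrite muEBb muBEb; move: main; set b := fine _ => main.
have b0 : (0 <= b)%R by exact: fine_ge0.
have young : (p * c * (b + b) <= p * a `^ (p - 1) * b ^+ 2 +
    p * c ^+ 2 * ((1 - p) * l `^ (- p) * a + p * l `^ (1 - p)))%R.
  have := @powR_le_tangent _ a l p a0 l0 p01.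
  have -> : (1 - p = - (p - 1))%R by rewrite opprB.
  rewrite powRN opprB; have := powR_gt0 (p - 1) a0.
  set z := (a `^ (p - 1))%R; set X := (_ + p * _)%R => z0 zX.
  (* With [z = a ^ (p - 1)], the square [(b - c / z) ^ 2] is nonnegative; then [z^-1 = a ^ (1 - p)]
     is bounded by its tangent at [l]. *)
  have sq : (c * (b + b) <= z * b ^+ 2 + c ^+ 2 * z^-1)%R.
    rewrite -subr_ge0.
    have -> : (z * b ^+ 2 + c ^+ 2 * z^-1 - c * (b + b) =
        z * (b - c / z) ^+ 2)%R.
      by field; exact: lt0r_neq0.
    by rewrite mulr_ge0 ?sqr_ge0// ltW.
  have czX := ler_wpM2l (exprn_ge0 2 c0) zX.
  have := ler_wpM2l p0 (le_trans sq (lerD (lexx _) czX)).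
  by rewrite [(p * (_ + _))%R]mulrDr !(mulrA p).
rewrite -EFinD -EFinM.
apply: (@le_trans _ _ (\int[mu]_(x in B `\` E) (s x `^ p)%:E +
  (p * a `^ (p - 1) * b ^+ 2)%:E +
  (p * c ^+ 2 * ((1 - p) * l `^ (- p) * a + p * l `^ (1 - p)))%:E)).
  by rewrite -addeA leeD2l// -EFinD lee_fin.
by rewrite leeD2r.
Qed.

Variables (u v : T -> R) (M L : R).
Hypotheses (meas_u : measurable_fun setT u) (mv : measurable_fun setT v).
Hypotheses (u0 : forall x, (0 <= u x)%R) (v0 : forall x, (0 <= v x)%R).
Hypotheses (M0 : (0 < M)%R) (uM : forall x, (u x <= M)%R).
Hypotheses (L0 : (0 < L)%R) (int_u : \int[mu]_x (u x)%:E = L%:E).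
Hypothesis level_v : forall t : R, (0 <= t)%R ->
  [set x | (t < v x)%R] = [set x | (s x)%:E < mu [set y | (t < u y)%R]].

(** The level set of [v] is a sublevel set of [s] cut at the measure of the level set of [u], and
    [s] is normalised so that this cut is its measure. *)
Lemma mu_level_v t : (0 <= t)%R ->
  mu [set x | (t < v x)%R] = mu [set x | (t < u x)%R].
Proof.
move=> t0; rewrite level_v//.
have : 0 <= mu [set y | (t < u y)%R] by exact: measure_ge0.
case: (mu [set y | _]) => [r| |]//.
  rewrite lee_fin => r0.
  transitivity (mu [set x | (s x < r)%R]); last exact: mu_lt.
  by congr (mu _); apply/funext => x /=; rewrite lte_fin.
(* Infinite measure: the level set of [v] is the whole space, which contains each [{s <= r}], of
   measure [r]. *)
move=> _; apply/eqyP => r r0.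
rewrite -(mu_le (ltW r0)); apply: le_measure; rewrite ?inE//.
- by apply: measurable_set_le => //; exact: measurable_cst.
- rewrite (_ : [set _ | _] = setT)//.
  by apply/seteqP; split=> x //= _; exact: ltry.
- by move=> x _ /=; exact: ltry.
Qed.

Lemma integral_equimeasurable : \int[mu]_x (v x)%:E = L%:E.
Proof.
rewrite -int_u !(integral_distribution mu measurableT)//.
apply: eq_integral => t; rewrite inE/= in_itv/= andbT => t0.
by rewrite !setTI mu_level_v.
Qed.

(** No point has [u > M], so a point with [v x > M] would satisfy [s x < 0]. *)
Let vM x : (v x <= M)%R.
Proof.
rewrite leNgt; apply/negP => Mv.
have : [set x | (M < v x)%R] x by [].
rewrite level_v ?(ltW M0)//= (_ : [set y | _] = set0).
  by rewrite measure0 lte_fin ltNge s0.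
by apply/seteqP; split=> y //=; rewrite ltNge uM.
Qed.

(** Chebyshev's inequality. At [t = 0] the measure may be infinite, hence the open interval []0, M[]
    of levels. *)
Let mu_level_fin t : (0 < t)%R -> mu [set x | (t < u x)%R] \is a fin_num.
Proof.
move=> t0; rewrite ge0_fin_numE//.
have mE : measurable [set x | (t < u x)%R].
  by apply: measurable_set_lt => //; exact: measurable_cst.
have : t%:E * mu [set x | (t < u x)%R] <= L%:E.
  rewrite -int_u -integral_cst//.
  apply: (@le_trans _ _ (\int[mu]_(x in [set x | (t < u x)%R]) (u x)%:E)).
    apply: ge0_le_integral => //.
    - by move=> x _; rewrite lee_fin ltW.
    - by apply/measurable_EFinP; exact: measurable_funTS.
    - by move=> x /= tu; rewrite lee_fin ltW.
  apply: ge0_subset_integral => //; first exact/measurable_EFinP.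
  by move=> x _; rewrite lee_fin.
have : 0 <= mu [set x | (t < u x)%R] by exact: measure_ge0.
case: (mu [set x | (t < u x)%R]) => [r _ _| _|]//; first by rewrite ltry.
by rewrite gt0_muley ?lte_fin.
Qed.

Let band (w f g : T -> R) (t : R) :=
  \int[mu]_(x in [set x | (f x <= t < g x)%R]) (w x)%:E.

(** All layer cakes are put on the same interval, since [f >= 0] and [g <= M]; dropping the single
    level [0] does not change the integral. *)
Let cake (w f g : T -> R) : measurable_fun setT w -> measurable_fun setT f ->
  measurable_fun setT g -> (forall x, (0 <= w x)%R) ->
  (forall x, (0 <= f x)%R) -> (forall x, (g x <= M)%R) ->
  \int[mu]_x (w x * Num.max (g x - f x) 0)%:E =
  \int[@lebesgue_measure R]_(t in `]0%R, M[) band w f g t.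
Proof.
move=> mw mf mg w0 f0 gM; rewrite integral_itv_obnd_cbnd; last first.
  by apply: measurable_band_integral.
apply: layer_cake => //.
move=> x t /andP[ft tg] /=; rewrite in_itv/= (le_trans (f0 x) ft)/=.
exact: lt_le_trans tg (gM x).
Qed.

Let mband (w f g : T -> R) : measurable_fun setT w -> measurable_fun setT f ->
  measurable_fun setT g -> (forall x, (0 <= w x)%R) ->
  measurable_fun (`]0%R, M[%classic : set (measurableTypeR R)) (band w f g).
Proof. by move=> mw mf mg w0; exact: measurable_band_integral. Qed.

Let band_ge0 (w f g : T -> R) t : (forall x, (0 <= w x)%R) -> 0 <= band w f g t.
Proof. by move=> w0; apply: integral_ge0 => x _; rewrite lee_fin. Qed.

Let ms_powR : measurable_fun setT (fun x => (s x `^ p)%R).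
Proof. exact: measurableT_comp (measurable_powR p) ms. Qed.

Let h x : R := (s x `^ p)%R.
Let h0 x : (0 <= h x)%R. Proof. exact: powR_ge0. Qed.
Let one : T -> R := cst 1%R.
Let zero : T -> R := cst 0%R.

(** With [E = {u > t}] and [B = {v > t}], the bands between [u] and [v] are [E \ B] and [B \ E], so
    this is [bathtub_linearized] for [a = mu E]. *)
Let level_inequality (c l t : R) : (0 <= c)%R -> (0 < l)%R -> (0 < t < M)%R ->
  band h u v t + (p * c)%:E * (band one v u t + band one u v t)
  <= band h v u t + ((p * c ^+ 2 * (1 - p) * l `^ (- p))%:E * band one zero u t
       + (p * c ^+ 2 * p * l `^ (1 - p))%:E).
Proof.
move=> c0 l0 /andP[t0 tM].
pose E := [set x | (t < u x)%R].
have mE : measurable E by apply: measurable_set_lt => //; exact: measurable_cst.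
have := mu_level_fin t0; rewrite -/E => /fineK; set a := fine _ => muE.
have vE : [set x | (t < v x)%R] = [set x | (s x < a)%R].
  rewrite level_v ?(ltW t0)// -/E -muE.
  by apply/funext => x /=; rewrite lte_fin.
have vuE : [set x | (v x <= t < u x)%R] = E `\` [set x | (s x < a)%R].
  rewrite -vE; apply/seteqP; split=> x /=.
    by move=> /andP[vt tu]; split=> //; apply/negP; rewrite -leNgt.
  by move=> [tu /negP]; rewrite -leNgt => vt; apply/andP.
have uvE : [set x | (u x <= t < v x)%R] = [set x | (s x < a)%R] `\` E.
  rewrite -vE; apply/seteqP; split=> x /=.
    by move=> /andP[vt tu]; split=> //; apply/negP; rewrite -leNgt.
  by move=> [tu /negP]; rewrite -leNgt => vt; apply/andP.
have ouE : [set x | (zero x <= t < u x)%R] = E.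
  by apply/funext => x /=; rewrite /zero/= (ltW t0).
have mB : measurable [set x | (s x < a)%R].
  by apply: measurable_set_lt => //; exact: measurable_cst.
rewrite /band vuE uvE ouE /one /= !integral_cst//; [|exact: measurableD..].
rewrite !mul1e.
have := bathtub_linearized mE (esym muE) c0 l0.
move=> /le_trans; apply; rewrite leeD2l//.
rewrite -[X in _ <= _ * X + _]/(mu E) -muE -EFinM -EFinD lee_fin le_eqVlt.
by apply/orP; left; apply/eqP; ring.
Qed.

(** The common value of [l ^ (- p) * L] and [l ^ (1 - p) * M] for [l = L / M]: this [l] balances the
    two terms of the tangent bound. *)
Let N : R := (L `^ (1 - p) * M `^ p)%R.

Let powR_inv (x r : R) : (0 < x)%R -> (x^-1 `^ r = x `^ (- r))%R.
Proof. by move=> x0; rewrite -powR_inv1 ?ltW// -powRrM mulN1r. Qed.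

Let gt0_powRD (x q r : R) : (0 < x)%R -> (x `^ (q + r) = x `^ q * x `^ r)%R.
Proof. by move=> x0; rewrite powRD// (gt_eqF x0) implybT. Qed.

Let ratio_powN : ((L / M) `^ (- p) * L = N)%R.
Proof.
rewrite powRM ?invr_ge0 ?ltW// powR_inv// opprK mulrAC; congr (_ * _)%R.
by rewrite gt0_powRD// powRr1 ?ltW// mulrC.
Qed.

Let ratio_powB : ((L / M) `^ (1 - p) * M = N)%R.
Proof.
rewrite powRM ?invr_ge0 ?ltW// powR_inv// -mulrA; congr (_ * _)%R.
rewrite -[X in (_ * X)%R](powRr1 (ltW M0)) -gt0_powRD//.
by congr powR; ring.
Qed.

(* Both sides may be infinite, which is why nothing is subtracted here. *)
Let integrated_inequality (c D : R) : (0 <= c)%R ->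
  \int[mu]_x `|u x - v x|%:E = D%:E ->
  \int[mu]_x (h x * Num.max (v x - u x) 0)%:E + (p * c * D)%:E
  <= \int[mu]_x (h x * Num.max (u x - v x) 0)%:E + (p * c ^+ 2 * N)%:E.
Proof.
move=> c0 DE; have /andP[p0 p1] := p01.
have p'0 : (0 <= 1 - p)%R by rewrite subr_ge0.
pose l : R := (L / M)%R.
have l0 : (0 < l)%R by rewrite divr_gt0.
have mmax (f g : T -> R) : measurable_fun setT f -> measurable_fun setT g ->
    measurable_fun setT (fun x => (one x * Num.max (f x - g x) 0)%:E).
  move=> mf mg; apply/measurable_EFinP; apply: measurable_funM => //.
  by apply: measurable_maxr => //; exact: measurable_funB.
have max0 (f g : T -> R) x : 0 <= (one x * Num.max (f x - g x) 0)%:E.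
  by rewrite lee_fin mul1r le_max lexx orbT.
have D_split : \int[mu]_x (one x * Num.max (u x - v x) 0)%:E +
   \int[mu]_x (one x * Num.max (v x - u x) 0)%:E = D%:E.
  rewrite -ge0_integralD//; [|exact: mmax..].
  rewrite -DE; apply: eq_integral => x _; rewrite -EFinD !mul1r; congr EFin.
  have [uv|/ltW vu] := leP (u x) (v x).
    rewrite max_r ?subr_le0// max_l ?subr_ge0// add0r distrC.
    by rewrite ger0_norm ?subr_ge0.
  rewrite max_l ?subr_ge0// max_r ?subr_le0// addr0.
  by rewrite ger0_norm ?subr_ge0.
have L_cake : \int[mu]_x (one x * Num.max (u x - zero x) 0)%:E = L%:E.
  by rewrite -int_u; apply: eq_integral => x _; rewrite mul1r subr0 max_l.
have mone : measurable_fun setT one by exact: measurable_cst.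
have mzero : measurable_fun setT zero by exact: measurable_cst.
have one0 x : (0 <= one x)%R by exact: ler01.
have zero0 x : (0 <= zero x)%R by exact: lexx.
have k1 : (0 <= p * c ^+ 2 * (1 - p) * l `^ (- p))%R.
  by rewrite !mulr_ge0 ?powR_ge0 ?exprn_ge0.
have k2 : (0 <= p * c ^+ 2 * p * l `^ (1 - p))%R.
  by rewrite !mulr_ge0 ?powR_ge0 ?exprn_ge0.
have k3 : (0 <= p * c)%R by rewrite mulr_ge0.
pose J := (`]0%R, M[%classic : set (measurableTypeR R)).
have mJ : measurable J by exact: measurable_itv.
(* The weights [1 - p] and [p] add up to [1]: the first share of [N] comes from the integral [L] of
   [mu {u > t}], the second from a constant over an interval of length [M]. *)
have Nsplit : (p * c ^+ 2 * N)%:E =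
    (p * c ^+ 2 * (1 - p) * l `^ (- p))%:E * L%:E
    + (p * c ^+ 2 * p * l `^ (1 - p))%:E * @lebesgue_measure R J.
  rewrite lebesgue_measure_itv/= lte_fin M0 sube0 -!EFinM -EFinD; congr EFin.
  have -> : (p * c ^+ 2 * (1 - p) * l `^ (- p) * L =
      p * c ^+ 2 * (1 - p) * N)%R by rewrite -mulrA ratio_powN.
  have -> : (p * c ^+ 2 * p * l `^ (1 - p) * M = p * c ^+ 2 * p * N)%R.
    by rewrite -mulrA ratio_powB.
  by ring.
have mb w f g := @mband w f g.
have mh : measurable_fun setT h by exact: ms_powR.
have [mb1 mb2] := (mb _ _ _ mh meas_u mv h0, mb _ _ _ mh mv meas_u h0).
have [mb3 mb4] := (mb _ _ _ mone meas_u mv one0, mb _ _ _ mone mv meas_u one0).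
have mb5 := mb _ _ _ mone mzero meas_u one0.
have b1 t := band_ge0 u v t h0; have b2 t := band_ge0 v u t h0.
have b3 t := band_ge0 u v t one0; have b4 t := band_ge0 v u t one0.
have b5 t := band_ge0 zero u t one0.
have mb34 := emeasurable_funD mb4 mb3.
have b34 t : 0 <= band one v u t + band one u v t by rewrite adde_ge0.
have mkb34 := measurable_funeM (p * c)%:E mb34.
have kb34 t : 0 <= (p * c)%:E * (band one v u t + band one u v t).
  by rewrite mule_ge0.
have mkb5 := measurable_funeM (p * c ^+ 2 * (1 - p) * l `^ (- p))%:E mb5.
have kb5 t : 0 <= (p * c ^+ 2 * (1 - p) * l `^ (- p))%:E * band one zero u t.
  by rewrite mule_ge0.
(* Every term, constants included, becomes an integral over [J] of a nonnegative function, which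
   reduces the claim to [level_inequality] at each level. *)
rewrite EFinM -D_split Nsplit -L_cake !cake//.
rewrite -integral_cst//.
rewrite -ge0_integralD//.
rewrite -ge0_integralZl//.
rewrite -ge0_integralD//.
rewrite -ge0_integralZl//.
rewrite -ge0_integralD//.
have mkb5c := emeasurable_funD mkb5
  (measurable_cst (p * c ^+ 2 * p * l `^ (1 - p))%:E).
have kb5c t : 0 <= (p * c ^+ 2 * (1 - p) * l `^ (- p))%:E * band one zero u t
    + (p * c ^+ 2 * p * l `^ (1 - p))%:E.
  by rewrite adde_ge0.
rewrite -ge0_integralD//.
apply: ge0_le_integral => //.
- by move=> t _; rewrite adde_ge0.
- exact: emeasurable_funD.
- exact: emeasurable_funD.
by move=> t; rewrite /= in_itv/=; exact: level_inequality.
Qed.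

Theorem stability_inequality (D : R) :
  \int[mu]_x `|u x - v x|%:E = D%:E ->
  \int[mu]_x (s x `^ p * Num.max (v x - u x) 0)%:E
    + (p * D ^+ 2 / (4 * (L `^ (1 - p) * M `^ p)))%:E
  <= \int[mu]_x (s x `^ p * Num.max (u x - v x) 0)%:E.
Proof.
move=> DE; have D0 : (0 <= D)%R.
  by rewrite -lee_fin -DE; apply: integral_ge0 => x _; rewrite lee_fin.
have N0 : (0 < N)%R by rewrite mulr_gt0 ?powR_gt0.
(* This [c] maximises [c * D - c ^ 2 * N], with maximum [D ^ 2 / (4 * N)]. *)
have c0 : (0 <= D / (2 * N))%R by rewrite divr_ge0// mulr_ge0// ltW.
have := integrated_inequality c0 DE; rewrite -/N.
(* One half of this term is the claimed gain; the other is the finite error term on the right, which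
   cancels. *)
rewrite (_ : (p * (D / (2 * N)) * D)%:E = (p * D ^+ 2 / (4 * N))%:E
  + (p * (D / (2 * N)) ^+ 2 * N)%:E); last first.
  by rewrite -EFinD; congr EFin; field; exact: lt0r_neq0.
by rewrite addeA leeD2rE.
Qed.

End stability.

(** * Volumes of balls *)

Section scaling.
Context (R : realType).
Local Notation RT := (measurableTypeR R).

Definition rescale (r : R) : RT -> RT := fun x : R => r * x.

Lemma measurable_rescale r : measurable_fun setT (rescale r).
Proof. exact: (@measurable_funM _ _ _ _ (cst r) id). Qed.

(** [r] times the pushforward under [rescale r] agrees with Lebesgue measure on the intervals []a,
    b]], hence on all measurable sets by uniqueness. *)
Lemma lebesgue_measure_rescale (r : R) (A : set RT) : 0 < r -> measurable A ->
  (lebesgue_measure (rescale r @^-1` A) = r^-1%:E * lebesgue_measure A)%E.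
Proof.
move=> r0 mA.
pose push : {measure set RT -> \bar R} :=
  measure_function_pushforward__canonical__measure_function_Measure
    (@lebesgue_measure R) (measurable_rescale r).
pose nu : {measure set RT -> \bar R} := mscale (NngNum (ltW r0)) push.
have nuE B : measurable B -> (lebesgue_measure B = nu B)%E.
  apply: lebesgue_measure_unique => _ [[a b] _ <-].
  rewrite /nu/= /mscale/= /pushforward.
  have -> : rescale r @^-1` `]a, b]%classic = `](a / r), (b / r)]%classic.
    apply/seteqP; split=> x; rewrite /rescale /= !in_itv/=;
      by rewrite ltr_pdivrMr// ler_pdivlMr// mulrC.
  rewrite !lebesgue_measure_itv/= !lte_fin ltr_pM2r ?invr_gt0//.
  case: ifPn => ab; last by rewrite mule0.
  by rewrite -!EFinB -EFinM -mulrBl mulrC divfK ?gt_eqF.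
by rewrite [in RHS]nuE// /nu/= /mscale/= muleA -EFinM mulVf ?gt_eqF// mul1e.
Qed.

Definition tscale d (r : R) (x : Rn R d) : Rn R d :=
  [tuple of map (rescale r) x].

Lemma tnth_tscale d r (x : Rn R d) i : tnth (tscale r x) i = r * tnth x i :> R.
Proof. by rewrite tnth_map. Qed.

(** Induction on [d] with Tonelli: the slice at [a] of the preimage is the preimage of the slice at
    [r * a], and the substitution in the first coordinate gives the last factor [r^-1]. *)
Lemma lebesgue_Rn_rescale d (r : R) (A : set (Rn R d)) :
  0 < r -> measurable A ->
  (lebesgue_Rn R d (tscale r @^-1` A) = (r^-1 ^+ d)%:E * lebesgue_Rn R d A)%E.
Proof.
move=> r0; elim: d A => [|d ih] A mA.
  rewrite expr0 mul1e; congr (lebesgue_Rn R 0 _).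
  by apply/funext => x; rewrite /preimage/= (tuple0 x) (tuple0 (tscale r _)).
rewrite /= /cons_measure /pushforward.
set A' := @tuple_of_pair _ RT d @^-1` A.
have mA' : measurable A'.
  rewrite -[X in measurable X]setTI; exact: measurable_tuple_of_pair.
pose F (a : RT) := lebesgue_Rn R d (xsection A' a).
have mF : measurable_fun setT F by exact: measurable_fun_xsection.
transitivity (\int[lebesgue_measure]_a ((r^-1 ^+ d)%:E * F (rescale r a)))%E.
  apply: eq_integral => a _ /=.
  rewrite /F -ih; last exact: measurable_xsection.
  congr (lebesgue_Rn R d _); apply/funext => t; rewrite /xsection/= !inE/=.
  by congr (A _); exact: val_inj.
rewrite ge0_integralZl//; last 2 first.
- exact: measurableT_comp mF (measurable_rescale r).
- by rewrite lee_fin exprn_ge0// invr_ge0 ltW.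
rewrite exprS EFinM [RHS]muleAC [RHS]muleC; congr (_ * _)%E.
pose push : {measure set RT -> \bar R} :=
  measure_function_pushforward__canonical__measure_function_Measure
    (@lebesgue_measure R) (measurable_rescale r).
have ri0 : 0 <= r^-1 by rewrite invr_ge0 ltW.
transitivity (\int[push]_a F a)%E.
  by rewrite ge0_integral_pushforward//; exact: measurable_rescale.
transitivity (\int[mscale (NngNum ri0) (@lebesgue_measure R)]_a F a)%E.
  apply: eq_measure_integral => B mB _ /=.
  by rewrite /pushforward lebesgue_measure_rescale.
by rewrite ge0_integral_mscale.
Qed.

Lemma enorm_ge0 d (x : Rn R d) : 0 <= enorm x.
Proof. exact: sqrtr_ge0. Qed.

Lemma enorm_tscale d (r : R) (x : Rn R d) : 0 <= r ->
  enorm (tscale r x) = r * enorm x.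
Proof.
move=> r0; rewrite /enorm.
under eq_bigr do rewrite tnth_tscale exprMn.
by rewrite -mulr_sumr sqrtrM ?sqr_ge0// sqrtr_sqr ger0_norm.
Qed.

Lemma measurable_enorm d : measurable_fun setT (@enorm R d).
Proof.
apply: (@measurableT_comp _ _ _ _ _ _ (@Num.sqrt R)).
  exact: continuous_measurable_fun (@sqrt_continuous R).
apply: measurable_sum => i.
apply: (@measurableT_comp _ _ _ _ _ _ (fun z : R => z ^+ 2)).
  exact: exprn_measurable.
exact: measurable_tnth.
Qed.

Lemma measurable_ball d (r : R) : measurable [set x : Rn R d | enorm x <= r].
Proof.
by apply: measurable_set_le; [exact: measurable_enorm|exact: measurable_cst].
Qed.

Lemma coord_le_enorm d (x : Rn R d) i : `|tnth x i : R| <= enorm x.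
Proof.
rewrite /enorm -sqrtr_sqr; apply: ler_wsqrtr.
by rewrite (bigD1 i)//= lerDl sumr_ge0// => j _; exact: sqr_ge0.
Qed.

(** Cubes have an explicit volume; enclosing the unit ball and fitting inside it, they show that its
    volume is finite and positive. *)
Definition cube d (r : R) : set (Rn R d) :=
  [set x | forall i : 'I_d, `|tnth x i : R| <= r].

Arguments cube : clear implicits.

Lemma ball_sub_cube d (r : R) : [set x : Rn R d | enorm x <= r] `<=` cube d r.
Proof. by move=> x xr i; exact: le_trans (coord_le_enorm x i) xr. Qed.

Lemma measurable_cube d (r : R) : measurable (cube d r).
Proof.
rewrite (_ : cube d r = \bigcap_(i in [set: 'I_d])
    [set x : Rn R d | `|tnth x i : R| <= r]).
  apply: fin_bigcap_measurable => // i _; apply: measurable_set_le.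
    by apply: measurableT_comp => //; exact: measurable_tnth.
  exact: measurable_cst.
by apply/seteqP; split=> [x xr i _|x xr i]; [exact: xr|exact: (xr i)].
Qed.

Lemma lebesgue_cube d (r : R) : 0 <= r ->
  lebesgue_Rn R d (cube d r) = ((2 * r) ^+ d)%:E.
Proof.
move=> r0.
have mI : forall i : 'I_d, measurable (`[- r, r]%classic : set RT) by [].
transitivity (lebesgue_Rn R d
    [set x | forall i, (`[- r, r]%classic : set RT) (tnth x i)]).
  congr (lebesgue_Rn R d _); apply/funext => x; apply/propext.
  by split=> xr i; have := xr i; rewrite /= in_itv/= ler_norml.
transitivity (\big[mule/1%E]_(i < d) (2 * r)%:E).
  rewrite (lebesgue_Rn_box mI); apply: eq_bigr => i _.
  rewrite lebesgue_measure_itv/= lte_fin; case: ifPn => rr.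
    by rewrite -EFinB; congr EFin; ring.
  by congr EFin; lra.
by elim: d {mI} => [|n ih]; rewrite ?big_ord0// big_ord_recl ih -EFinM -exprS.
Qed.

Lemma unit_ball_volumeE d :
  lebesgue_Rn R d [set x | enorm x <= 1] = (unit_ball_volume R d)%:E.
Proof.
rewrite /unit_ball_volume fineK// ge0_fin_numE//.
apply: (@le_lt_trans _ _ (lebesgue_Rn R d
    (cube d 1))).
  apply: le_measure; rewrite ?inE.
  - exact: measurable_ball.
  - exact: measurable_cube.
  exact: ball_sub_cube.
by rewrite lebesgue_cube// ltry.
Qed.

Lemma unit_ball_volume_gt0 d : 0 < unit_ball_volume R d.
Proof.
rewrite -lte_fin -unit_ball_volumeE.
(* A cube in the unit ball: [c ^ 2 <= c], so a sum of [d] squares is at most [d * c <= 1]. With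
   [d.+1] the witness is positive for [d = 0] too. *)
pose c : R := d.+1%:R^-1.
have c0 : 0 < c by rewrite invr_gt0.
apply: (@lt_le_trans _ _ (lebesgue_Rn R d
    (cube d c))).
  by rewrite lebesgue_cube ?(ltW c0)// lte_fin exprn_gt0// mulr_gt0.
apply: le_measure; rewrite ?inE.
- exact: measurable_cube.
- exact: measurable_ball.
move=> x /= xc; rewrite /enorm -[leRHS]sqrtr1; apply: ler_wsqrtr.
apply: (@le_trans _ _ (\sum_(i < d) c)).
  apply: ler_sum => i _; have xic := xc i.
  rewrite -real_normK ?num_real// expr2.
  apply: (@le_trans _ _ (c * 1)); last by rewrite mulr1.
  apply: ler_pM => //; apply: le_trans xic _.
  by rewrite invf_le1 ?ler1n.
rewrite sumr_const card_ord -mulr_natl ler_pdivrMr// mul1r ler_nat.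
exact: leqnSn.
Qed.

Lemma lebesgue_ball d (r : R) : (0 < d)%N -> 0 <= r ->
  lebesgue_Rn R d [set x | enorm x <= r] = (unit_ball_volume R d * r ^+ d)%:E.
Proof.
move=> d0; rewrite le_eqVlt => /predU1P[<-|r0].
  (* Scaling needs [0 < r]; the ball of radius [0] lies in a cube of volume [0 ^ d], which is [0] as
     [0 < d]. *)
  rewrite expr0n gtn_eqF// mulr0; apply/eqP; rewrite eq_le measure_ge0 andbT.
  apply: (@le_trans _ _ (lebesgue_Rn R d
      (cube d 0))).
    apply: le_measure; rewrite ?inE.
    - exact: measurable_ball.
    - exact: measurable_cube.
    exact: ball_sub_cube.
  by rewrite lebesgue_cube// mulr0 expr0n gtn_eqF.
have ri0 : 0 < r^-1 by rewrite invr_gt0.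
have -> : [set x : Rn R d | enorm x <= r] =
    tscale r^-1 @^-1` [set x | enorm x <= 1].
  apply/funext => x; rewrite /preimage/= enorm_tscale ?(ltW ri0)//.
  by rewrite mulrC ler_pdivrMr// mul1r.
rewrite lebesgue_Rn_rescale//; last exact: measurable_ball.
by rewrite invrK unit_ball_volumeE -EFinM mulrC.
Qed.

(** The normalisation [mu_le] required of [s] in the abstract argument; the set is the ball of
    volume [r]. *)
Lemma lebesgue_volume_le d (r : R) : (0 < d)%N -> 0 <= r ->
  lebesgue_Rn R d [set x | unit_ball_volume R d * enorm x ^+ d <= r] = r%:E.
Proof.
move=> d0 r0; have K0 := unit_ball_volume_gt0 d.
pose rho := (r / unit_ball_volume R d) `^ (d%:R^-1).
have rho0 : 0 <= rho by exact: powR_ge0.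
have rhoE : rho ^+ d = r / unit_ball_volume R d.
  rewrite -powR_mulrn// -powRrM mulVf ?pnatr_eq0 ?gtn_eqF//.
  by rewrite powRr1// divr_ge0// ltW.
have -> : [set x : Rn R d | unit_ball_volume R d * enorm x ^+ d <= r] =
    [set x | enorm x <= rho].
  apply/funext => x /=; rewrite -ler_pdivlMl// mulrC -rhoE.
  by rewrite ler_pXn2r// nnegrE enorm_ge0.
by rewrite lebesgue_ball// rhoE mulrC divfK ?gt_eqF.
Qed.

End scaling.

(** * Level sets of the rearrangement *)

Section level_sets.
Context (R : realType) (d : nat).
Local Notation mu := (lebesgue_Rn R d).
Variable u : Rn R d -> R.
Hypothesis meas_u : measurable_fun setT u.
Let a (t : R) := mu [set x | t < u x].

Let mlevel t : measurable [set x | t < u x].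
Proof. by apply: measurable_set_lt => //; exact: measurable_cst. Qed.

Let a_noninc (t t' : R) : t <= t' -> (a t' <= a t)%E.
Proof.
by move=> tt'; apply: le_measure; rewrite ?inE// => x /=; exact: le_lt_trans.
Qed.

(** Right continuity of the distribution function: [{u > t}] is the increasing union of the sets
    [{u > t + 1 / (n + 1)}]. *)
Let a_right (t sigma : R) : (forall t', t < t' -> (a t' <= sigma%:E)%E) ->
  (a t <= sigma%:E)%E.
Proof.
move=> le_sigma.
pose F (n : nat) := [set x | t + n.+1%:R^-1 < u x].
have bigF : \bigcup_n F n = [set x | t < u x].
  apply/seteqP; split=> x /=.
    by move=> [n _] /=; apply: lt_trans; rewrite ltrDl invr_gt0.
  rewrite -subr_gt0 => ux.
  have [n nx] := ltr_add_invr ux.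
  by exists n => //; rewrite /F/= -ltrBrDl; move: nx; rewrite add0r.
have ndF : {homo F : n m / (n <= m)%N >-> (n <= m)%O}.
  move=> n m nm; apply/subsetPset => x /=; apply: le_lt_trans.
  by rewrite lerD2l lef_pV2 ?posrE// ler_nat ltnS.
have := nondecreasing_cvg_mu (mu := mu) (fun n => mlevel _) _ ndF.
rewrite bigF => /(_ (mlevel _)) /(cvge_le _); apply.
apply: nearW => n /=; apply: le_sigma.
by rewrite ltrDl invr_gt0.
Qed.

(** The infimum defining the rearrangement is taken over a set containing [M] and bounded below by
    [0]; right continuity makes the equivalence exact, with strict inequalities on both sides. *)
Lemma lt_decr_rearr (M sigma t : R) : 0 <= M -> mu [set x | M < u x] = 0%E ->
  0 <= sigma -> 0 <= t ->
  (t < decr_rearr u sigma) = (sigma%:E < mu [set x | (t < u x)%R])%E.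
Proof.
move=> M0 aM sigma0 t0; rewrite /decr_rearr; set S := [set _ | _].
have SM : S M by split=> //; rewrite aM lee_fin.
have Slb : lbound S 0 by move=> x [].
apply/idP/idP => [tS|].
  rewrite ltNge; apply/negP => at_.
  have : inf S <= t by apply: ge_inf; [exists 0|split].
  by rewrite leNgt tS.
move=> sa; rewrite ltNge; apply/negP => St.
(* By right continuity the strict inequality persists at some [t' > t], and monotonicity makes [t']
   a lower bound of [S]. *)
have [t' [tt' sa']] : exists t', t < t' /\ (sigma%:E < a t')%E.
  apply: contrapT => noex; move: sa; apply/negP; rewrite -leNgt.
  apply: a_right => t' tt'; rewrite leNgt; apply/negP => sa'.
  by apply: noex; exists t'.
have : t' <= inf S.
  apply: lb_le_inf; first by exists M.
  move=> x [x0 ax]; rewrite leNgt; apply/negP => xt'.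
  by have := lt_le_trans sa' (le_trans (a_noninc (ltW xt')) ax); rewrite ltxx.
by apply/negP; rewrite -ltNge (le_lt_trans St).
Qed.

End level_sets.

(** * Measurability from level sets, and sets equal almost everywhere *)

Lemma measurable_fun_levels d (T : measurableType d) (R : realType)
    (v : T -> R) :
  (forall x, 0 <= v x) ->
  (forall t, 0 <= t -> measurable [set x | t < v x]) -> measurable_fun setT v.
Proof.
move=> v0 mv; apply: (measurability _ (RGenOInfty.measurableE R)).
move=> _ [_ [t ->] <-]; rewrite setTI.
have [t0|t0] := leP 0 t.
  rewrite (_ : _ @^-1` _ = [set x | t < v x]); first exact: mv.
  by apply/funext => x; rewrite /= in_itv/= andbT.
rewrite (_ : _ @^-1` _ = setT)//.
by apply/seteqP; split=> x //= _; rewrite in_itv/= andbT (lt_le_trans t0).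
Qed.

Lemma ae_eq_measure d (T : measurableType d) (R : realType)
    (mu : {measure set T -> \bar R}) (A B : set T) :
  measurable A -> measurable B -> {ae mu, forall x, A x <-> B x} -> mu A = mu B.
Proof.
move=> mA mB AB; rewrite -[A]setIT -[B]setIT -!integral_indic//.
apply: ge0_ae_eq_integral => //.
- by apply/measurable_EFinP; exact: measurable_indic.
- by apply/measurable_EFinP; exact: measurable_indic.
apply: filterS AB => x ABx _; rewrite !indicE.
by congr ((nat_of_bool _)%:R)%:E; apply/idP/idP; rewrite !inE => /ABx.
Qed.

(** * The weighted inequality for the Schwarz rearrangement *)

Section main.
Context (R : realType) (d : nat).
Hypothesis d_gt0 : (0 < d)%N.
Local Notation mu := (lebesgue_Rn R d).
Local Notation K := (unit_ball_volume R d).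
Variables (u : Rn R d -> R) (M L : R).
Hypotheses (meas_u : measurable_fun setT u) (M0 : 0 < M) (L0 : 0 < L).
Hypothesis u_range : {ae mu, forall x, 0 <= u x <= M}.
Hypothesis int_u : (\int[mu]_x `|u x|%:E)%E = L%:E.
Let s (x : Rn R d) : R := K * enorm x ^+ d.
Let v := schwarz_rearr u.

Let K0 : 0 < K. Proof. exact: unit_ball_volume_gt0. Qed.

Let s0 x : 0 <= s x.
Proof. by rewrite mulr_ge0 ?exprn_ge0 ?enorm_ge0// ltW. Qed.

Let ms : measurable_fun setT s.
Proof.
apply: measurable_funM => //.
apply: (@measurableT_comp _ _ _ _ _ _ (fun z : R => z ^+ d)).
  exact: exprn_measurable.
exact: measurable_enorm.
Qed.

(* [u] takes values in [0, M] only almost everywhere; [clamp] does so everywhere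
   and has level sets of the same measure, hence the same rearrangement [v]. *)
Let clamp (x : Rn R d) : R := Num.min (Num.max (u x) 0) M.

Let mclamp : measurable_fun setT clamp.
Proof. by apply: measurable_minr => //; exact: measurable_maxr. Qed.

Let clamp0 x : 0 <= clamp x.
Proof. by rewrite le_min (ltW M0) le_max lexx orbT. Qed.

Let clampM x : clamp x <= M.
Proof. by rewrite ge_min lexx orbT. Qed.

Let clamp_ae : {ae mu, forall x, clamp x = u x}.
Proof.
apply: filterS u_range => x /andP[ux uM].
by rewrite /clamp max_l// min_l.
Qed.

Let mlevel (f : Rn R d -> R) (t : R) :
  measurable_fun setT f -> measurable [set x | t < f x].
Proof. by move=> mf; apply: measurable_set_lt => //; exact: measurable_cst. Qed.

Let level_clamp (t : R) : mu [set x | t < clamp x] = mu [set x | t < u x].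
Proof.
apply: ae_eq_measure; [exact: mlevel|exact: mlevel|].
by apply: filterS clamp_ae => x /= ->.
Qed.

Let level_M : mu [set x | M < u x] = 0%E.
Proof.
rewrite -level_clamp (_ : [set _ | _] = set0) ?measure0//.
by apply/seteqP; split=> x //=; rewrite ltNge clampM.
Qed.

Let level_v (t : R) : 0 <= t ->
  [set x | t < v x] = [set x | ((s x)%:E < mu [set y | (t < clamp y)%R])%E].
Proof.
move=> t0; apply/funext => x /=; rewrite level_clamp.
by rewrite (lt_decr_rearr meas_u (ltW M0) level_M _ t0)//; exact: s0.
Qed.

Let v0 x : 0 <= v x.
Proof.
rewrite /v /schwarz_rearr /decr_rearr; apply: lb_le_inf; last by move=> y [].
by exists M; split; [exact: ltW|rewrite level_M lee_fin; exact: s0].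
Qed.

(** Each level set of [v] at [t >= 0] is a sublevel set of [s], or the whole space when the cut is
    infinite. *)
Let mv : measurable_fun setT v.
Proof.
apply: measurable_fun_levels => // t t0; rewrite level_v//.
have : (0 <= mu [set y | (t < clamp y)%R])%E by exact: measure_ge0.
case: (mu [set y | _]) => [r _| _|]//.
  rewrite (_ : [set _ | _] = [set x | s x < r]).
    by apply: measurable_set_lt => //; exact: measurable_cst.
  by apply/funext => x /=; rewrite lte_fin.
rewrite (_ : [set _ | _] = setT)//.
by apply/seteqP; split=> x //= _; exact: ltry.
Qed.

Let mu_s_le (r : R) : 0 <= r -> mu [set x | s x <= r] = r%:E.
Proof. exact: lebesgue_volume_le. Qed.

Let int_clamp : (\int[mu]_x (clamp x)%:E)%E = L%:E.
Proof.
rewrite -int_u; apply: ge0_ae_eq_integral => //.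
- exact/measurable_EFinP.
- by apply/measurable_EFinP; exact: measurableT_comp.
- by move=> x _; rewrite lee_fin.
apply: filterS2 clamp_ae u_range => x -> /andP[ux _] _.
by rewrite ger0_norm.
Qed.

Let int_v : (\int[mu]_x (v x)%:E)%E = L%:E.
Proof.
exact: (integral_equimeasurable ms mu_s_le mclamp mv clamp0 v0 int_clamp
  level_v).
Qed.

(** Triangle inequality, as [u] and [v] both have [L^1] norm [L]. *)
Lemma integral_abs_sub_lty : (\int[mu]_x `|u x - v x|%:E < +oo)%E.
Proof.
apply: (@le_lt_trans _ _ (\int[mu]_x (`|u x|%:E + (v x)%:E))%E).
  apply: ge0_le_integral => //.
  - by apply/measurable_EFinP/measurableT_comp => //; exact: measurable_funB.
  - apply: emeasurable_funD; apply/measurable_EFinP => //.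
    exact: measurableT_comp.
  - move=> x _; rewrite -EFinD lee_fin (le_trans (ler_normB _ _))//.
    by rewrite (ger0_norm (v0 x)).
rewrite ge0_integralD//.
- by rewrite int_u int_v -EFinD ltry.
- by apply/measurable_EFinP; exact: measurableT_comp.
- by move=> x _; rewrite lee_fin.
- exact/measurable_EFinP.
Qed.

Variable m : R.
Hypotheses (m0 : 0 <= m) (m_le : m <= d%:R).
Let p : R := m / d%:R.

Let p01 : 0 <= p <= 1.
Proof. by rewrite divr_ge0//= ler_pdivrMr ?ltr0n// mul1r. Qed.

Let enorm_powR x : enorm x `^ m = K `^ (- p) * s x `^ p.
Proof.
rewrite powRM ?exprn_ge0 ?enorm_ge0 ?(ltW K0)// mulrA -powRD; last first.
  by rewrite (gt_eqF K0) implybT.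
rewrite addNr powRr0 mul1r -powR_mulrn ?enorm_ge0// -powRrM /p mulrC divfK//.
by rewrite pnatr_eq0 gtn_eqF.
Qed.

(** Passes at once from the weight [|x|^m] to [s ^ p] and, almost everywhere, from [u] to [clamp];
    it serves for both the positive and the negative part. *)
Let half_integral (g g' : Rn R d -> R) (h : Rn R d -> \bar R) :
  measurable_fun setT g -> measurable_fun setT g' ->
  measurable_fun setT h -> (forall x, 0 <= h x)%E ->
  {ae mu, forall x, h x = (enorm x `^ m * Num.max (g x - g' x) 0)%:E} ->
  (\int[mu]_x h x =
    (K `^ (- p))%:E * \int[mu]_x (s x `^ p * Num.max (g x - g' x) 0)%:E)%E.
Proof.
move=> mg mg' mh h0 hE.
have mF : measurable_fun setT (fun x => (s x `^ p * Num.max (g x - g' x) 0)%:E).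
  apply/measurable_EFinP; apply: measurable_funM.
    exact: measurableT_comp (measurable_powR p) ms.
  by apply: measurable_maxr => //; exact: measurable_funB.
have F0 x : (0 <= (s x `^ p * Num.max (g x - g' x) 0)%:E)%E.
  by rewrite lee_fin mulr_ge0 ?powR_ge0// le_max lexx orbT.
rewrite -ge0_integralZl//; last by rewrite lee_fin powR_ge0.
apply: ge0_ae_eq_integral => //.
- exact: measurable_funeM.
- by move=> x _; rewrite mule_ge0// lee_fin powR_ge0.
apply: filterS hE => x -> _.
by rewrite -EFinM mulrA -enorm_powR.
Qed.

Lemma weighted_stability (D : R) (G : Rn R d -> \bar R) :
  G = (fun x => (enorm x `^ m * (u x - v x))%:E) ->
  (\int[mu]_x `|u x - v x|%:E)%E = D%:E ->
  (\int[mu]_x G^\- x +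
     (K `^ (- p) * (p * D ^+ 2 / (4 * (L `^ (1 - p) * M `^ p))))%:E
   <= \int[mu]_x G^\+ x)%E.
Proof.
move=> GE DE.
have DE' : (\int[mu]_x `|clamp x - v x|%:E)%E = D%:E.
  rewrite -DE; apply: ge0_ae_eq_integral => //.
  - by apply/measurable_EFinP/measurableT_comp => //; exact: measurable_funB.
  - by apply/measurable_EFinP/measurableT_comp => //; exact: measurable_funB.
  by apply: filterS clamp_ae => x -> _.
have stab := stability_inequality ms s0 mu_s_le p01 mclamp mv clamp0 v0 M0
  clampM L0 int_clamp level_v DE'.
have mG : measurable_fun setT G.
  rewrite GE; apply/measurable_EFinP; apply: measurable_funM.
    exact: measurableT_comp (measurable_powR m) (@measurable_enorm R d).
  exact: measurable_funB.
have e0 (x : Rn R d) : 0 <= enorm x `^ m by exact: powR_ge0.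
rewrite (@half_integral clamp v (G^\+)%E)//; last 2 first.
- exact: measurable_funepos.
- apply: filterS clamp_ae => x ->.
  by rewrite funeposE GE -EFin_max maxr_pMr// mulr0.
rewrite (@half_integral v clamp (G^\-)%E)//; last 2 first.
- exact: measurable_funeneg.
- apply: filterS clamp_ae => x ->.
  by rewrite funenegE GE -EFinN -EFin_max maxr_pMr// mulr0 -mulrN opprB.
rewrite EFinM -muleDr//; last by rewrite fin_num_adde_defl.
by rewrite lee_wpmul2l// lee_fin powR_ge0.
Qed.

End main.

(** * The inequality in terms of norms *)

Theorem corollary1 (R : realType) (d : nat) (hd : (1 <= d)%N)
    (u : Rn R d -> R) (m : R)
    (u_L1 : u \in Lfun (lebesgue_Rn R d) 1%E)
    (u_Loo : u \in Lfun (lebesgue_Rn R d) +oo%E)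
    (u_ge0 : {ae lebesgue_Rn R d, forall x, 0 <= u x})
    (u_neq0 : ~ {ae lebesgue_Rn R d, forall x, u x = 0})
    (m_ge0 : 0 <= m) (m_le : m <= d%:R)
    (int_wd : integral_well_defined (lebesgue_Rn R d)
       (fun x => (enorm x `^ m * (u x - schwarz_rearr u x))%:E)) :
  ((m / (4 * d%:R) * unit_ball_volume R d `^ (- (m / d%:R)))%:E
     * 'N[lebesgue_Rn R d]_1[EFin \o u] `^ (-1 + m / d%:R)
     * 'N[lebesgue_Rn R d]_+oo[EFin \o u] `^ (- (m / d%:R))
     * 'N[lebesgue_Rn R d]_1[EFin \o (u \- schwarz_rearr u)%R] ^+ 2
   <= \int[lebesgue_Rn R d]_x (enorm x `^ m * (u x - schwarz_rearr u x))%:E)%E.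
Proof.
set mu := lebesgue_Rn R d.
have meas_u : measurable_fun setT u by exact: set_mem (sub_Lfun_mfun u_L1).
have meu : measurable_fun setT (EFin \o u) by exact/measurable_EFinP.
have N1_lty : ('N[mu]_1[EFin \o u] < +oo)%E.
  exact: set_mem (sub_Lfun_finLfun u_L1).
have Noo_lty : ('N[mu]_+oo[EFin \o u] < +oo)%E.
  exact: set_mem (sub_Lfun_finLfun u_Loo).
(* The norm of exponent [+oo] is the essential supremum once the space has positive measure. *)
have muT : (0 < mu setT)%E.
  apply: (@lt_le_trans _ _ (mu [set x | enorm x <= 1])).
    by rewrite unit_ball_volumeE lte_fin unit_ball_volume_gt0.
  by apply: le_measure; rewrite ?inE//; exact: measurable_ball.
have N1E : ('N[mu]_1[EFin \o u] = (fine 'N[mu]_1[EFin \o u])%:E)%E.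
  by rewrite fineK// ge0_fin_numE// Lnorm_ge0.
have NooE : ('N[mu]_+oo[EFin \o u] = (fine 'N[mu]_+oo[EFin \o u])%:E)%E.
  by rewrite fineK// ge0_fin_numE// Lnorm_ge0.
have Noo_sup : 'N[mu]_+oo[EFin \o u]%E = ess_sup mu (abse \o (EFin \o u)).
  by rewrite Lnorm.unlock muT.
move: N1E NooE; set L := fine _; set M := fine _ => N1E NooE.
have u_le : {ae mu, forall x, `|u x| <= M}.
  have := ess_sup_ge mu (abse \o (EFin \o u)).
  rewrite -Noo_sup NooE.
  by apply: filterS => x /=; rewrite lee_fin.
have int_u : (\int[mu]_x `|u x|%:E)%E = L%:E by rewrite -N1E Lnorm1.
have u_range : {ae mu, forall x, 0 <= u x <= M}.
  apply: filterS2 u_ge0 u_le => x ux; rewrite ux/= => /(le_trans _); apply.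
  exact: ler_norm.
have M0 : 0 < M.
  have M_ge0 : 0 <= M by rewrite fine_ge0// Lnorm_ge0.
  rewrite lt_neqAle M_ge0 andbT; apply/negP => /eqP M_eq0; apply: u_neq0.
  by apply: filterS u_range => x; rewrite -M_eq0 -eq_le => /eqP.
have L0 : 0 < L.
  have L_ge0 : 0 <= L by rewrite fine_ge0// Lnorm_ge0.
  rewrite lt_neqAle L_ge0 andbT; apply/negP => /eqP L_eq0; apply: u_neq0.
  have /(ae_eq_integral_abs mu measurableT meu) :
      (\int[mu]_x `|(EFin \o u) x|)%E = 0%E.
    by rewrite -[RHS]/(0%:E) L_eq0 -int_u.
  by apply: filterS => x /(_ I) [].
have v_int := integral_abs_sub_lty hd meas_u M0 u_range int_u.
have DE : ('N[mu]_1[EFin \o (u \- schwarz_rearr u)%R] =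
    (fine 'N[mu]_1[EFin \o (u \- schwarz_rearr u)%R])%:E)%E.
  by rewrite fineK// ge0_fin_numE ?Lnorm_ge0// Lnorm1.
move: DE; set D := fine _ => DE.
have int_uv : (\int[mu]_x `|u x - schwarz_rearr u x|%:E)%E = D%:E.
  by rewrite -DE Lnorm1.
rewrite N1E NooE DE !poweR_EFin -EFin_expe -!EFinM.
set G := fun x => (enorm x `^ m * (u x - schwarz_rearr u x))%:E.
have := weighted_stability hd meas_u M0 L0 u_range int_u m_ge0 m_le (erefl G)
  int_uv.
set C := (X in (_ + X%:E)%E) => stab.
(* If the positive part has a finite integral, [stab] bounds that of the negative part; otherwise
   well-definedness gives its finiteness. Only now may it be moved to the other side. *)
have neg_fin : (\int[mu]_x G^\- x)%E \is a fin_num.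
  rewrite ge0_fin_numE; last by apply: integral_ge0 => x _; exact: funeneg_ge0.
  case: int_wd => // pos_lty; rewrite ltey; apply/eqP => neg_oo.
  by move: (le_lt_trans stab pos_lty); rewrite neg_oo addye.
rewrite (_ : m / (4 * d%:R) * _ * _ * _ * _ = C).
  by rewrite integralE leeBrDr// addeC; exact: stab.
have K0 := unit_ball_volume_gt0 R d.
have -> : -1 + m / d%:R = - (1 - m / d%:R) by rewrite opprB addrC.
rewrite /C !powRN.
have := powR_gt0 (m / d%:R) K0; have := powR_gt0 (m / d%:R) M0.
have := powR_gt0 (1 - m / d%:R) L0.
set l := L `^ _; set k := M `^ _; set n := unit_ball_volume R d `^ _.
move=> l0 k0 n0.
have d0 : d%:R != 0 :> R by rewrite pnatr_eq0 -lt0n.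
by field; rewrite d0 !gt_eqF.
Qed.
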